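(* Let $(\mathcal{A}_n)_{n\in\mathbb N}$ be a sequence of unital Banach algebras such that $\mathrm{Asy}(\mathcal{A}_n)$ is properly infinite. Then there is an $N\in\mathbb N$ such that $\mathcal{A}_n$ is properly infinite for every $n\ge N$.
   Context: Banach algebras are complex and have a contractive product $\|ab\|\le\|a\|\|b\|$; a unital Banach algebra has unit $1$ with $\|1\|=1$. For a sequence $(\mathcal A_n)$ of Banach algebras, $\ell^\infty(\mathcal A_n)$ is the Banach algebra of all bounded sequences $(a_n)$ with $a_n\in\mathcal A_n$, with pointwise operations and the supremum norm; $c_0(\mathcal A_n)$ is the closed two-sided ideal of sequences with $\lim_{n\to\infty}\|a_n\|=0$; and $\mathrm{Asy}(\mathcal A_n)=\ell^\infty(\mathcal A_n)/c_0(\mathcal A_n)$ with the quotient norm. Two idempotents $p,q$ in an algebra $\mathcal A$ are equivalent, $p\sim q$, if there are $a,b\in\mathcal A$ with $p=ab$ and $q=ba$; they are orthogonal if $pq=0=qp$. A unital algebra $\mathcal A$ is properly infinite if there are orthogonal idempotents $p,q\in\mathcal A$ with $p\sim 1$ and $q\sim 1$. *)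

(* Defs.v *)
From HB Require Import structures.
From mathcomp Require Import all_boot all_order all_algebra.
From mathcomp Require Import generic_quotient ring_quotient.
From mathcomp Require Import complex.
From mathcomp Require Import boolp classical_sets functions reals topology.
From mathcomp Require Import normedtype sequences.

Set Implicit Arguments.
Unset Strict Implicit.
Unset Printing Implicit Defensive.

Import Order.TTheory GRing.Theory Num.Theory.
Import numFieldNormedType.Exports.

Local Open Scope classical_set_scope.
Local Open Scope ring_scope.
Local Open Scope quotient_scope.

(* The product is part of the mixin because Hierarchy Builder rejects a structure
   inheriting from both the normed modules over a parameter K and the rings (their
   join is already NumDomain, whose norm takes its values in the ring itself).  The
   ring and algebra structures are attached below to every unitalBanachAlgType. *)
HB.mixin Record isUnitalBanachAlgebra (K : numFieldType) A
    of CompleteNormedModule K A := {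
  uba_one : A;
  uba_mul : A -> A -> A;
  uba_mulA : associative uba_mul;
  uba_mul1 : left_id uba_one uba_mul;
  uba_mulone : right_id uba_one uba_mul;
  uba_mulDl : left_distributive uba_mul +%R;
  uba_mulDr : right_distributive uba_mul +%R;
  uba_scaleAl : forall (k : K) (a b : A),
    k *: uba_mul a b = uba_mul (k *: a) b;
  uba_scaleAr : forall (k : K) (a b : A),
    k *: uba_mul a b = uba_mul a (k *: b);
  uba_normM : forall a b : A, `|uba_mul a b| <= `|a| * `|b|;
  uba_norm1 : `|uba_one| = 1
}.

#[short(type="unitalBanachAlgType")]
HB.structure Definition UnitalBanachAlgebra (K : numFieldType) :=
  {A of CompleteNormedModule K A & isUnitalBanachAlgebra K A}.

Section UnitalBanachAlgebraTheory.
Variables (K : numFieldType) (A : unitalBanachAlgType K).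

Fact uba_one_neq0 : (uba_one : A) != 0.
Proof. by rewrite -normr_eq0 uba_norm1 oner_eq0. Qed.

#[non_forgetful_inheritance]
HB.instance Definition _ := GRing.Zmodule_isNzRing.Build A
  (@uba_mulA K A) (@uba_mul1 K A) (@uba_mulone K A) (@uba_mulDl K A)
  (@uba_mulDr K A) uba_one_neq0.
#[non_forgetful_inheritance]
HB.instance Definition _ :=
  GRing.Lmodule_isLalgebra.Build K A (@uba_scaleAl K A).
#[non_forgetful_inheritance]
HB.instance Definition _ :=
  GRing.Lalgebra_isAlgebra.Build K A (@uba_scaleAr K A).

Lemma normrM_le (a b : A) : `|a * b| <= `|a| * `|b|.
Proof. exact: uba_normM. Qed.

Lemma normr_one : `|1 : A| = 1. Proof. exact: uba_norm1. Qed.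

End UnitalBanachAlgebraTheory.

Section ProperlyInfinite.
Variable A : pzRingType.
Implicit Types p q : A.

Definition is_idempotent p := p * p = p.

Definition equiv_idem p q := exists a b : A, p = a * b /\ q = b * a.

Definition orthogonal_idem p q := p * q = 0 /\ q * p = 0.

Definition properly_infinite := exists p q : A,
  [/\ is_idempotent p, is_idempotent q, orthogonal_idem p q,
      equiv_idem p 1 & equiv_idem q 1].

End ProperlyInfinite.
Arguments properly_infinite : clear implicits.

Section Asy.
Variables (K : numFieldType) (A : nat -> unitalBanachAlgType K).

Definition seqs := forall n, A n.

HB.instance Definition _ := gen_eqMixin seqs.
HB.instance Definition _ := gen_choiceMixin seqs.

Section Pointwise.
Implicit Types (a b c : seqs) (k : K).

Let add a b : seqs := fun n => a n + b n.
Let opp a : seqs := fun n => - a n.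
Let zero : seqs := fun n => 0.
Let one : seqs := fun n => 1.
Let mul a b : seqs := fun n => a n * b n.
Let scale k a : seqs := fun n => k *: a n.

Let addA : associative add.
Proof. by move=> a b c; apply: functional_extensionality_dep => n; exact: addrA. Qed.
Let addC : commutative add.
Proof. by move=> a b; apply: functional_extensionality_dep => n; exact: addrC. Qed.
Let add0 : left_id zero add.
Proof. by move=> a; apply: functional_extensionality_dep => n; exact: add0r. Qed.
Let addN : left_inverse zero opp add.
Proof. by move=> a; apply: functional_extensionality_dep => n; exact: addNr. Qed.

HB.instance Definition _ := GRing.isZmodule.Build seqs addA addC add0 addN.

Let mulA : associative mul.
Proof. by move=> a b c; apply: functional_extensionality_dep => n; exact: mulrA. Qed.
Let mul1 : left_id one mul.
Proof. by move=> a; apply: functional_extensionality_dep => n; exact: mul1r. Qed.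
Let mulone : right_id one mul.
Proof. by move=> a; apply: functional_extensionality_dep => n; exact: mulr1. Qed.
Let mulDl : left_distributive mul add.
Proof. by move=> a b c; apply: functional_extensionality_dep => n; exact: mulrDl. Qed.
Let mulDr : right_distributive mul add.
Proof. by move=> a b c; apply: functional_extensionality_dep => n; exact: mulrDr. Qed.
Let one_neq0 : one != zero :> seqs.
Proof. by apply/eqP => /(congr1 (@^~ 0%N)) /eqP; rewrite /one oner_eq0. Qed.

HB.instance Definition _ :=
  GRing.Zmodule_isNzRing.Build seqs mulA mul1 mulone mulDl mulDr one_neq0.

Let scaleA k l a : scale k (scale l a) = scale (k * l) a.
Proof. by apply: functional_extensionality_dep => n; exact: scalerA. Qed.
Let scale1 : left_id 1 scale.
Proof. by move=> a; apply: functional_extensionality_dep => n; exact: scale1r. Qed.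
Let scaleDr : right_distributive scale +%R.
Proof. by move=> k a b; apply: functional_extensionality_dep => n; exact: scalerDr. Qed.
Let scaleDl a : {morph scale^~ a : k l / k + l >-> k + l}.
Proof. by move=> k l; apply: functional_extensionality_dep => n; exact: scalerDl. Qed.

HB.instance Definition _ :=
  GRing.Zmodule_isLmodule.Build K seqs scaleA scale1 scaleDr scaleDl.

Let scaleAl k a b : k *: (a * b) = k *: a * b.
Proof. by apply: functional_extensionality_dep => n; exact: scalerAl. Qed.
Let scaleAr k a b : k *: (a * b) = a * (k *: b).
Proof. by apply: functional_extensionality_dep => n; exact: scalerAr. Qed.

HB.instance Definition _ := GRing.Lmodule_isLalgebra.Build K seqs scaleAl.
HB.instance Definition _ := GRing.Lalgebra_isAlgebra.Build K seqs scaleAr.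

End Pointwise.

Lemma seqsD (a b : seqs) n : (a + b) n = a n + b n. Proof. by []. Qed.
Lemma seqsN (a : seqs) n : (- a) n = - a n. Proof. by []. Qed.
Lemma seqs0 n : (0 : seqs) n = 0. Proof. by []. Qed.
Lemma seqs1 n : (1 : seqs) n = 1. Proof. by []. Qed.
Lemma seqsM (a b : seqs) n : (a * b) n = a n * b n. Proof. by []. Qed.
Lemma seqsZ (k : K) (a : seqs) n : (k *: a) n = k *: a n. Proof. by []. Qed.

(* Norms take values in K; for K = R[i] the condition `|a n| <= M forces M to be a
   nonnegative real. *)
Definition bounded_seqs : pred seqs :=
  fun a => `[< exists M : K, forall n, `|a n| <= M >].

Fact bounded_seqs_subalg : subalg_closed bounded_seqs.
Proof.
split.
- by apply/asboolP; exists 1 => n; rewrite seqs1 normr_one.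
- move=> k a b /asboolP[M aM] /asboolP[N bN]; apply/asboolP.
  exists (`|k| * M + N) => n; rewrite seqsD seqsZ.
  rewrite (le_trans (ler_normD _ _))// normrZ; apply: lerD; last exact: bN.
  apply: ler_wpM2l; [exact: normr_ge0|exact: aM].
- move=> a b /asboolP[M aM] /asboolP[N bN]; apply/asboolP.
  exists (M * N) => n; rewrite seqsM.
  by rewrite (le_trans (normrM_le _ _))// ler_pM.
Qed.

HB.instance Definition _ :=
  GRing.isSubalgClosed.Build K seqs bounded_seqs bounded_seqs_subalg.

Record linfty := Linfty { linfty_val : seqs; _ : linfty_val \in bounded_seqs }.

HB.instance Definition _ := [isSub for linfty_val].
HB.instance Definition _ := [Choice of linfty by <:].
HB.instance Definition _ := [SubChoice_isSubAlgebra of linfty by <:].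

Definition c0 : pred linfty :=
  fun a => `[< (fun n => `|val a n| : K) @ \oo --> (0 : K) >].

Lemma c0P (a : linfty) :
  reflect (forall e : K, 0 < e -> \forall n \near \oo, `|val a n| < e)
          (a \in c0).
Proof.
apply: (iffP (asboolP _)) => [a0 e e0|a0].
  have /cvgrPdist_lt/(_ _ e0) := a0.
  by apply: filterS => n; rewrite sub0r normrN normr_id.
by apply/cvgrPdist_lt => e /a0; apply: filterS => n; rewrite sub0r normrN normr_id.
Qed.

Fact c0_zmod : zmod_closed c0.
Proof.
split; first by apply/c0P => e e0; apply: nearW => n; rewrite /= normr0.
move=> a b /c0P a0 /c0P b0; apply/c0P => e e0.
have e20 : 0 < e / 2 by rewrite divr_gt0.
move: (a0 _ e20) (b0 _ e20); apply: filterS2 => n an bn /=.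
by rewrite (le_lt_trans (ler_normB _ _))// [e]splitr ltrD.
Qed.

HB.instance Definition _ := GRing.isZmodClosed.Build linfty c0 c0_zmod.

Lemma c0Ml (a b : linfty) : b \in c0 -> a * b \in c0.
Proof.
case/asboolP: (valP a) => M aM /c0P b0; apply/c0P => e e0.
have M0 : 0 <= M := le_trans (normr_ge0 _) (aM 0%N).
have M10 : 0 < M + 1 by rewrite ltr_wpDl.
have := b0 (e / (M + 1)) (divr_gt0 e0 M10); apply: filterS => n bn /=.
rewrite (le_lt_trans (normrM_le _ _))//.
rewrite (@le_lt_trans _ _ ((M + 1) * `|val b n|))//.
  by rewrite ler_wpM2r// (le_trans (aM n))// lerDl.
by rewrite mulrC -ltr_pdivlMr.
Qed.

Lemma c0Mr (a b : linfty) : a \in c0 -> a * b \in c0.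
Proof.
case/asboolP: (valP b) => M bM /c0P a0; apply/c0P => e e0.
have M0 : 0 <= M := le_trans (normr_ge0 _) (bM 0%N).
have M10 : 0 < M + 1 by rewrite ltr_wpDl.
have := a0 (e / (M + 1)) (divr_gt0 e0 M10); apply: filterS => n an /=.
rewrite (le_lt_trans (normrM_le _ _))//.
rewrite (@le_lt_trans _ _ (`|val a n| * (M + 1)))//.
  by rewrite ler_wpM2l// (le_trans (bM n))// lerDl.
by rewrite -ltr_pdivlMr.
Qed.

Lemma c0_proper : 1 \notin c0.
Proof.
apply/negP => /c0P/(_ 1 ltr01)[N _ /(_ N (leqnn N))] /=.
by rewrite normr_one ltxx.
Qed.

Lemma c0Z (k : K) (a : linfty) : a \in c0 -> k *: a \in c0.
Proof. by move=> a0; rewrite -[a]mul1r scalerAl c0Ml. Qed.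

Local Notation c0z := (GRing.ZmodClosed.clone linfty c0 _).

(* Only the algebra structure of l^oo(A_n) / c_0(A_n) is installed: proper
   infiniteness does not involve the quotient norm. *)
Definition Asy := Quotient.quot c0z.

HB.instance Definition _ := GRing.Zmodule.on Asy.
HB.instance Definition _ := EqQuotient.on Asy.

Definition asy_pi (a : linfty) : Asy := \pi_Asy a.

Lemma asy_piP (a b : linfty) : asy_pi a = asy_pi b <-> a - b \in c0.
Proof. by rewrite -[_ \in _]/(_ \in c0z) Quotient.idealrBE; split => /eqP. Qed.

Lemma asy_reprK (x : Asy) : asy_pi (repr x) = x.
Proof. exact: reprK. Qed.

Lemma asy_repr_pi (a : linfty) : repr (asy_pi a) - a \in c0.
Proof. by apply/asy_piP; rewrite asy_reprK. Qed.

Lemma asy_piD (a b : linfty) : asy_pi (a + b) = asy_pi a + asy_pi b.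
Proof. by exact: (@Quotient.pi_add _ c0z). Qed.

Section AsyOperations.
Implicit Types (a b : linfty) (x y z : Asy) (k : K).

Let one : Asy := asy_pi 1.
Let mul x y : Asy := asy_pi (repr x * repr y).
Let scale k x : Asy := asy_pi (k *: repr x).

Let mul_pi a b : mul (asy_pi a) (asy_pi b) = asy_pi (a * b).
Proof.
apply/asy_piP.
set a' := repr _; set b' := repr _.
have -> : a' * b' - a * b = (a' - a) * b' + a * (b' - b).
  by rewrite mulrBl mulrBr addrA subrK.
by apply: rpredD; [apply: c0Mr|apply: c0Ml]; exact: asy_repr_pi.
Qed.

Let scale_pi k a : scale k (asy_pi a) = asy_pi (k *: a).
Proof. by apply/asy_piP; rewrite -scalerBr c0Z// asy_repr_pi. Qed.

Let mulA : associative mul.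
Proof.
move=> x y z; rewrite -[x]asy_reprK -[y]asy_reprK -[z]asy_reprK.
by rewrite !mul_pi mulrA.
Qed.
Let mul1 : left_id one mul.
Proof. by move=> x; rewrite -[x]asy_reprK mul_pi mul1r. Qed.
Let mulone : right_id one mul.
Proof. by move=> x; rewrite -[x]asy_reprK mul_pi mulr1. Qed.
Let mulDl : left_distributive mul +%R.
Proof.
move=> x y z; rewrite -[x]asy_reprK -[y]asy_reprK -[z]asy_reprK.
by rewrite -asy_piD !mul_pi mulrDl asy_piD.
Qed.
Let mulDr : right_distributive mul +%R.
Proof.
move=> x y z; rewrite -[x]asy_reprK -[y]asy_reprK -[z]asy_reprK.
by rewrite -asy_piD !mul_pi mulrDr asy_piD.
Qed.
Let one_neq0 : one != 0.
Proof.
have -> : 0 = asy_pi 0 by apply: (@addIr _ (asy_pi 0)); rewrite -asy_piD !add0r.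
by apply/eqP => /asy_piP; rewrite subr0; apply/negP; exact: c0_proper.
Qed.

HB.instance Definition _ :=
  GRing.Zmodule_isNzRing.Build Asy mulA mul1 mulone mulDl mulDr one_neq0.

Let scaleA k l x : scale k (scale l x) = scale (k * l) x.
Proof. by rewrite -[x]asy_reprK !scale_pi scalerA. Qed.
Let scale1 : left_id 1 scale.
Proof. by move=> x; rewrite -[x]asy_reprK scale_pi scale1r. Qed.
Let scaleDr : right_distributive scale +%R.
Proof.
move=> k x y; rewrite -[x]asy_reprK -[y]asy_reprK.
by rewrite -asy_piD !scale_pi scalerDr asy_piD.
Qed.
Let scaleDl x : {morph scale^~ x : k l / k + l >-> k + l}.
Proof. by move=> k l; rewrite -[x]asy_reprK !scale_pi scalerDl asy_piD. Qed.

HB.instance Definition _ :=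
  GRing.Zmodule_isLmodule.Build K Asy scaleA scale1 scaleDr scaleDl.

Let mulE x y : x * y = mul x y. Proof. by []. Qed.
Let scaleE k x : k *: x = scale k x. Proof. by []. Qed.

Let scaleAl k x y : k *: (x * y) = k *: x * y.
Proof.
rewrite !mulE !scaleE -[x]asy_reprK -[y]asy_reprK.
by rewrite !(mul_pi, scale_pi) scalerAl.
Qed.
Let scaleAr k x y : k *: (x * y) = x * (k *: y).
Proof.
rewrite !mulE !scaleE -[x]asy_reprK -[y]asy_reprK.
by rewrite !(mul_pi, scale_pi) scalerAr.
Qed.

HB.instance Definition _ := GRing.Lmodule_isLalgebra.Build K Asy scaleAl.
HB.instance Definition _ := GRing.Lalgebra_isAlgebra.Build K Asy scaleAr.

Lemma asy_piM a b : asy_pi (a * b) = asy_pi a * asy_pi b.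
Proof. by rewrite mulE mul_pi. Qed.

Lemma asy_piZ k a : asy_pi (k *: a) = k *: asy_pi a.
Proof. by rewrite scaleE scale_pi. Qed.

Lemma asy_pi1 : asy_pi 1 = 1. Proof. by []. Qed.

End AsyOperations.

End Asy.

(* Main.v *)
Require Import Defs.
From HB Require Import structures.
From mathcomp Require Import all_boot all_order all_algebra.
From mathcomp Require Import complex reals.
From mathcomp Require Import boolp classical_sets topology normedtype sequences.
From mathcomp Require Import ring.

(** In a ring, proper infiniteness amounts to elements with [b a = d c = 1] and
    [b c = d a = 0].  Lifting such elements from the asymptotic algebra gives
    these relations in [A_n] up to a small error.  Right inverses supplied by
    the Neumann series, together with one Gram-Schmidt step, turn the
    approximate relations into exact ones. *)

Local Open Scope complex_scope.

Import Order.TTheory GRing.Theory Num.Theory.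
Import numFieldNormedType.Exports.
Local Open Scope ring_scope.

(** With [p = a * b] and [q = c * d] one has [b * p = b] and [q * c = c], so
    [b * c = b * (p * q) * c] vanishes; [d * a] is symmetric. Conversely, [a * b] and [c * d] serve
    as the two idempotents. *)
Lemma properly_infiniteP (A : pzRingType) :
  properly_infinite A <->
  exists a b c d : A, [/\ b * a = 1, d * c = 1, b * c = 0 & d * a = 0].
Proof.
split=> [[p [q [_ _ [pq qp] [a [b [pE ba]]] [c [d [qE dc]]]]]]|].
  exists a, b, c, d; split=> //.
    have -> : b * c = b * (p * q) * c.
      by rewrite pE qE !mulrA -ba mul1r -!mulrA -dc mulr1.
    by rewrite pq mulr0 mul0r.
  have -> : d * a = d * (q * p) * a.
    by rewrite pE qE !mulrA -dc mul1r -!mulrA -ba mulr1.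
  by rewrite qp mulr0 mul0r.
move=> [a [b [c [d [ba dc bc da]]]]]; exists (a * b), (c * d); split.
- by rewrite /is_idempotent mulrA -[a * b * a]mulrA ba mulr1.
- by rewrite /is_idempotent mulrA -[c * d * c]mulrA dc mulr1.
- split; first by rewrite mulrA -[a * b * c]mulrA bc mulr0 mul0r.
  by rewrite mulrA -[c * d * a]mulrA da mulr0 mul0r.
- by exists a, b.
- by exists c, d.
Qed.

(** A positive element of [R[i]] has zero imaginary part, so the claim reduces to the Archimedean
    property of [R]. *)
Lemma complex_half_expn_lt (R : realType) (e : R[i]) :
  0 < e -> exists n : nat, 2^-1 ^+ n < e.
Proof.
case: e => e f; rewrite ltcE /= => /andP[/eqP -> e0].
exists (Num.bound e^-1).
have -> : (2^-1 : R[i]) = (2^-1)%:C by rewrite fmorphV rmorphMn rmorph1.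
rewrite -rmorphXn ltcR.
rewrite exprVn invf_plt ?posrE ?exprn_gt0 //.
apply: lt_trans (archi_boundP _) _; first by rewrite invr_ge0 ltW.
by rewrite -natrX ltr_nat ltn_expl.
Qed.

Section UnitalBanachAlgebra.
Variables (R : realType) (A : unitalBanachAlgType R[i]).

Lemma normrX_le (y : A) (n : nat) : `|y ^+ n| <= `|y| ^+ n.
Proof.
elim: n => [|n IHn]; first by rewrite !expr0 normr_one.
by rewrite !exprS (le_trans (normrM_le _ _)) // ler_wpM2l.
Qed.

Lemma norm_neumann_tail_le (y : A) (m n : nat) : `|y| <= 2^-1 ->
  `|\sum_(n <= i < n + m) y ^+ i| <= 2 * 2^-1 ^+ n.
Proof.
move=> y2.
(* Subtracting the rest of the geometric series gives a sharper bound that is stable under induction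
   on [m]. *)
suff H : `|\sum_(n <= i < n + m) y ^+ i| <= 2 * 2^-1 ^+ n - 2 * 2^-1 ^+ (n + m).
  by apply: (le_trans H); rewrite gerBl mulr_ge0 // exprn_ge0 // invr_ge0.
elim: m => [|m IHm]; first by rewrite addn0 big_geq // normr0 subrr.
rewrite addnS big_nat_recr ?leq_addr //=.
apply: (le_trans (ler_normD _ _)).
have yX : `|y ^+ (n + m)| <= 2^-1 ^+ (n + m).
  by rewrite (le_trans (normrX_le _ _)) // lerXn2r ?nnegrE ?invr_ge0.
apply: (le_trans (lerD IHm yX)); rewrite exprS mulrA divff ?pnatr_eq0 //.
by rewrite mul1r le_eqVlt; apply/orP; left; apply/eqP; ring.
Qed.

(** The inverse is the sum of the powers of [y = 1 - x]: its partial sums satisfy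
    [x * s n = 1 - y ^+ n], are Cauchy by the tail estimate, and have norm at most 2. *)
Lemma neumann_right_inverse (x : A) : `|1 - x| <= 2^-1 ->
  exists2 w : A, x * w = 1 & `|w| <= 2.
Proof.
set y := 1 - x => y2.
pose s n : A := \sum_(0 <= i < n) y ^+ i.
have xs n : x * s n = 1 - y ^+ n.
  have -> : x = 1 - y by rewrite /y opprB addrC subrK.
  by rewrite /s big_mkord -[LHS]opprK -mulNr opprB -subrX1 opprB.
have sB m n : (n <= m)%N -> `|s m - s n| <= 2 * 2^-1 ^+ n.
  move=> nm; rewrite /s (big_cat_nat (n := n)) //= addrAC subrr add0r.
  by rewrite -(subnKC nm) norm_neumann_tail_le.
have s2 n : `|s n| <= 2.
  by have := sB n 0%N isT; rewrite /s [X in _ - X]big_geq // subr0 expr0 mulr1.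
have : cvg (s @ \oo)%classic.
  apply/cauchy_cvgP/cauchy_exP => e e0.
  have [n ne] := @complex_half_expn_lt R (e / 2) (divr_gt0 e0 (ltr0Sn _ 1)).
  exists (s n), n => // m /= nm.
  rewrite -ball_normE /= distrC (le_lt_trans (sB _ _ nm)) //.
  by rewrite mulrC -ltr_pdivlMr.
move=> /cvg_ex[w /cvgrPdist_lt sw]; exists w.
  apply/eqP; rewrite -subr_eq0 -normr_le0; apply/ler_addgt0Pr => e e0.
  rewrite add0r.
  (* Adding 1 keeps the divisor positive even when [x = 0]. *)
  have x0 : 0 < `|x| + 1 by rewrite ltr_wpDl.
  have e20 : 0 < e / 2 by rewrite divr_gt0.
  have [n ne] := @complex_half_expn_lt R _ e20.
  have [k _ /(_ (maxn k n) (leq_maxl _ _))] := sw _ (divr_gt0 e20 x0).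
  (* This index is large enough both for [w - s m] and for [y ^+ m]; each contributes at most
     [e / 2]. *)
  set m := maxn k n => wsm.
  have -> : x * w - 1 = x * (w - s m) - y ^+ m.
    by rewrite mulrBr xs -addrA -opprD subrK.
  rewrite [e]splitr (le_trans (ler_normB _ _)) // lerD //.
    apply: (le_trans (normrM_le _ _)).
    rewrite (@le_trans _ _ ((`|x| + 1) * `|w - s m|)) ?ler_wpM2r ?lerDl //.
    by rewrite mulrC -ler_pdivlMr // ltW.
  apply: (le_trans (normrX_le _ _)).
  apply: (@le_trans _ _ (2^-1 ^+ m)).
    by rewrite lerXn2r ?nnegrE ?invr_ge0.
  apply: (le_trans _ (ltW ne)).
  by rewrite ler_wiXn2l ?invr_ge0 ?invf_le1 ?ler1n ?leq_maxr.
apply/ler_addgt0Pr => e e0.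
have [m _ /(_ m (leqnn m)) wsm] := sw _ e0.
rewrite -[w](subrK (s m)) (le_trans (ler_normD _ _)) // addrC lerD //.
exact: ltW.
Qed.

Lemma approx_properly_infinite (a b c d : A) :
  `|1 - b * a| <= 4^-1 -> `|1 - d * c| <= 4^-1 ->
  `|b * c| <= 4^-1 -> `|d * a| <= 4^-1 ->
  properly_infinite A.
Proof.
move=> ba dc bc da; apply/properly_infiniteP.
have quarter : (4^-1 : R[i]) + 4^-1 = 2^-1 by field.
have [w baw w2] : exists2 w : A, b * a * w = 1 & `|w| <= 2.
  apply: neumann_right_inverse; rewrite (le_trans ba) // -quarter.
  by rewrite lerDl invr_ge0.
(* Gram-Schmidt step: [a * w * b] is idempotent because [b * a * w = 1], and its complement [r] will
   correct [c] and [d]. *)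
pose r := 1 - a * w * b.
have br : b * r = 0 by rewrite mulrBr mulr1 !mulrA baw mul1r subrr.
have rw : r * (a * w) = 0.
  by rewrite mulrBl mul1r -[a * w * b * _]mulrA [b * _]mulrA baw mulr1 subrr.
have [v drcv _] : exists2 v : A, d * r * c * v = 1 & `|v| <= 2.
  apply: neumann_right_inverse.
  (* The first term has norm at most 1/4. In the second, [d * a * w] has norm at most 2/4, hence at
     most 1, and [b * c] at most 1/4, so the total is at most 1/2. *)
  have -> : 1 - d * r * c = (1 - d * c) + d * a * w * (b * c).
    by rewrite mulrBr mulr1 mulrBl opprB addrCA addrC !mulrA.
  rewrite -quarter (le_trans (ler_normD _ _)) // lerD //.
  apply: (le_trans (normrM_le _ _)); rewrite -[leRHS]mul1r ler_pM //.
  apply: (le_trans (normrM_le _ _)).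
  apply: (@le_trans _ _ (4^-1 * 2)); first by rewrite ler_pM.
  by rewrite mulrC ler_pdivrMr // mul1r ler_nat.
exists (a * w), b, (r * c * v), (d * r); split.
- by rewrite mulrA.
- have rr : r * r = r by rewrite {2}/r mulrBr mulr1 mulrA rw mul0r subr0.
  by rewrite !mulrA -[d * r * r]mulrA rr.
- by rewrite !mulrA br !mul0r.
- by rewrite -mulrA rw mulr0.
Qed.

End UnitalBanachAlgebra.

Theorem theorem4p2 (R : realType) (A : nat -> unitalBanachAlgType R[i]) :
  properly_infinite (Asy A) ->
  exists N : nat, forall n : nat, (N <= n)%N -> properly_infinite (A n).
Proof.
move=> /properly_infiniteP[a [b [c [d]]]].
rewrite -[a]asy_reprK -[b]asy_reprK -[c]asy_reprK -[d]asy_reprK.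
move: (repr a) (repr b) (repr c) (repr d) => {}a {}b {}c {}d.
(* Writing 0 as a class turns all four relations into memberships in [c0]. *)
have pi0 : 0 = asy_pi (0 : linfty A).
  by apply: (@addIr _ (asy_pi 0)); rewrite -asy_piD !add0r.
rewrite -!asy_piM -asy_pi1 pi0.
move=> [/esym/asy_piP/c0P ba /esym/asy_piP/c0P dc /asy_piP/c0P bc /asy_piP/c0P da].
have q0 : 0 < 4^-1 :> R[i] by rewrite invr_gt0.
(* Four null sequences are simultaneously below 1/4 from some index on. *)
have [N _ HN] := filterI (filterI (ba _ q0) (dc _ q0)) (filterI (bc _ q0) (da _ q0)).
exists N => n /HN /= [[{}ba {}dc] [{}bc {}da]].
move: bc da; rewrite !subr0 => bc da.
exact: (@approx_properly_infinite _ _ (val a n) (val b n) (val c n) (val d n)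
  (ltW ba) (ltW dc) (ltW bc) (ltW da)).
Qed.
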